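(* Let $\{\mathbf m_{h,\varepsilon}^i\}_{i=0}^N$ be generated by the constraint-preserving inexact midpoint solver described in the context. Then, for each $i=0,1,\dots,N-1$, $$\|d_t\mathbf m_{h,\varepsilon}^{i+1}\|_h^2+\frac{\gamma}{2\alpha k}\left[\mathfrak a_{h,\lambda}(\mathbf m_{h,\varepsilon}^{i+1},\mathbf m_{h,\varepsilon}^{i+1})-\mathfrak a_{h,\lambda}(\mathbf m_{h,\varepsilon}^i,\mathbf m_{h,\varepsilon}^i)\right]=\gamma\langle\mathbf s_{h,\varepsilon}^{i+1},d_t\mathbf m_{h,\varepsilon}^{i+1}\rangle_h-\frac{\gamma^2}{\alpha}\langle\mathbf s_{h,\varepsilon}^{i+1},\mathcal H_{h,\lambda}\overline{\mathbf m}_{h,\varepsilon}^{i+\frac12}\rangle_h ,$$ where $\mathbf s_{h,\varepsilon}^{i+1}:=I_h\big[\overline{\mathbf m}_{h,\varepsilon}^{i+\frac12}\times\mathcal H_{h,\lambda}(\boldsymbol\eta_{h,\varepsilon}^{i,\ell_\ast+1}-\boldsymbol\eta_{h,\varepsilon}^{i,\ell_\ast})\big]$. In particular, whenever $\mathbf s_{h,\varepsilon}^{i+1}=\mathbf 0$, the energy identity $$\frac{\gamma}{2\alpha}\left[\mathfrak a_{h,\lambda}(\mathbf m_{h,\varepsilon}^{i+1},\mathbf m_{h,\varepsilon}^{i+1})-\mathfrak a_{h,\lambda}(\mathbf m_{h,\varepsilon}^i,\mathbf m_{h,\varepsilon}^i)\right]+k\|d_t\mathbf m_{h,\varepsilon}^{i+1}\|_h^2=0$$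 is recovered.
   Context: Domain and spaces: $d\in\{1,2,3\}$; $\Omega\subset\mathbb R^d$ is an open bounded convex polytopal domain; $\mathbb H^1=H^1(\Omega;\mathbb R^3)$; $\langle\cdot,\cdot\rangle$ is the $L^2(\Omega)$ inner product of vector- or matrix-valued functions. The curl of an $\mathbb R^3$-valued function is the usual one for $d=3$, $\nabla\times\mathbf v=(\partial_2v_3,-\partial_1v_3,\partial_1v_2-\partial_2v_1)$ for $d=2$, and $\nabla\times\mathbf v=(0,-\partial_1v_3,\partial_1v_2)$ for $d=1$. $T,\alpha,\gamma,\kappa_{\mathrm e}>0$ and $\kappa_{\mathrm d}\in\mathbb R$ are constants; $\mathbf m^0$ is a continuous initial datum with $|\mathbf m^0|=1$ pointwise; $N\in\mathbb N$, $k=T/N$; $d_t\mathbf v^{i+1}=(\mathbf v^{i+1}-\mathbf v^i)/k$. Finite elements: $\{\mathcal T_h\}_{h>0}$ is a shape-regular, quasi-uniform family of triangulations of $\Omega$ with maximal mesh size $h$ and vertex set $\mathcal N_h$; $\mathbb V_h$ is the space of continuous $\mathbb R^3$-valued functions that are affine on each $K\in\mathcal T_h$; $I_h:C^0(\overline\Omega;\mathbb R^3)\to\mathbb V_h$ is nodal interpolation; $\varphi_z$ ($z\in\mathcal N_h$) are the scalar nodal $P_1$ basis functions and $\beta_z=\int_\Omega\varphi_z\,dx$. The mass-lumped product of continuous fields is $\langle\mathbf u,\mathbf v\rangle_h=\sum_{z\in\mathcal N_h}\beta_z\,\mathbf u(z)\cdot\mathbf v(z)$, with $\|\mathbf v\|_h^2=\langle\mathbf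 v,\mathbf v\rangle_h$. $\mathcal M_h=\{\boldsymbol\phi_h\in\mathbb V_h:|\boldsymbol\phi_h(z)|=1\ \forall z\in\mathcal N_h\}$. Bilinear forms: $\mathfrak a(\mathbf v,\boldsymbol\chi)=\kappa_{\mathrm e}\langle\nabla\mathbf v,\nabla\boldsymbol\chi\rangle+\kappa_{\mathrm d}\langle\mathbf v,\nabla\times\boldsymbol\chi\rangle+\kappa_{\mathrm d}\langle\nabla\times\mathbf v,\boldsymbol\chi\rangle$; $\mathfrak a_{h,\lambda}(\mathbf v_h,\boldsymbol\chi_h)=\mathfrak a(\mathbf v_h,\boldsymbol\chi_h)+\lambda\langle\mathbf v_h,\boldsymbol\chi_h\rangle_h$, where $\lambda>0$ is a fixed constant (independent of $h$) chosen large enough that $\mathfrak a_{h,\lambda}(\mathbf v_h,\mathbf v_h)\ge c_\lambda\|\mathbf v_h\|_{\mathbb H^1}^2$ for all $\mathbf v_h\in\mathbb V_h$ with $c_\lambda>0$ independent of $h$. $\mathcal H_{h,\lambda}:\mathbb V_h\to\mathbb V_h$ is defined by $\langle\mathcal H_{h,\lambda}\mathbf v_h,\boldsymbol\chi_h\rangle_h=-\mathfrak a_{h,\lambda}(\mathbf v_h,\boldsymbol\chi_h)$ for all $\boldsymbol\chi_h\in\mathbb V_h$. Constraint-preserving inexact midpoint solver: set $\mathbf m_{h,\varepsilon}^0=I_h\mathbf m^0$. For $i=0,\dots,N-1$, given $\mathbf m_{h,\varepsilon}^i\in\mathcal M_h$ and a tolerance $\varepsilon_{i+1}>0$: put $\boldsymbol\eta_{h,\varepsilon}^{i,0}=\mathbf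 m_{h,\varepsilon}^i$; for $\ell=0,1,2,\dots$ compute $\boldsymbol\eta_{h,\varepsilon}^{i,\ell+1}\in\mathbb V_h$ such that for all $\boldsymbol\phi_h\in\mathbb V_h$ $$\langle\boldsymbol\eta_{h,\varepsilon}^{i,\ell+1},\boldsymbol\phi_h\rangle_h+\alpha\langle\boldsymbol\eta_{h,\varepsilon}^{i,\ell+1}\times\mathbf m_{h,\varepsilon}^i,\boldsymbol\phi_h\rangle_h+\tfrac{\gamma k}{2}\langle\boldsymbol\eta_{h,\varepsilon}^{i,\ell+1}\times\mathcal H_{h,\lambda}\boldsymbol\eta_{h,\varepsilon}^{i,\ell},\boldsymbol\phi_h\rangle_h=\langle\mathbf m_{h,\varepsilon}^i,\boldsymbol\phi_h\rangle_h;$$ stop at the first index $\ell_\ast\ge0$ with $\big\|I_h\big[\boldsymbol\eta_{h,\varepsilon}^{i,\ell_\ast+1}\times\mathcal H_{h,\lambda}(\boldsymbol\eta_{h,\varepsilon}^{i,\ell_\ast+1}-\boldsymbol\eta_{h,\varepsilon}^{i,\ell_\ast})\big]\big\|_h\le\varepsilon_{i+1}$; set $\overline{\mathbf m}_{h,\varepsilon}^{i+\frac12}=\boldsymbol\eta_{h,\varepsilon}^{i,\ell_\ast+1}$ and $\mathbf m_{h,\varepsilon}^{i+1}=2\overline{\mathbf m}_{h,\varepsilon}^{i+\frac12}-\mathbf m_{h,\varepsilon}^i$. *)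

(* Defs.v *)
From HB Require Import structures.
From mathcomp Require Import all_boot all_order all_algebra.
From mathcomp Require Import all_classical all_reals all_analysis.

Set Implicit Arguments.
Unset Strict Implicit.
Unset Printing Implicit Defensive.

Import Order.TTheory GRing.Theory Num.Theory.
Import numFieldNormedType.Exports.

Local Open Scope classical_set_scope.
Local Open Scope ring_scope.

Section lebesgue_cons.
Variables (R : realType) (n : nat).
Variable mu : {sigma_finite_measure set (n.-tuple (measurableTypeR R)) -> \bar R}.

Let T1 : measurableType _ := measurableTypeR R.
Let Tn : measurableType _ := n.-tuple (measurableTypeR R).

Definition tcons (p : T1 * Tn) : n.+1.-tuple (measurableTypeR R) :=
  [tuple of p.1 :: p.2].

Definition lebesgue_cons : set (n.+1.-tuple (measurableTypeR R)) -> \bar R :=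
  pushforward (lebesgue_measure \x mu)%E tcons.

Let mtcons : measurable_fun [set: T1 * Tn] tcons.
Proof. exact: measurable_cons. Qed.

Let lebesgue_cons0 : lebesgue_cons set0 = 0%E.
Proof. by rewrite /lebesgue_cons /pushforward preimage_set0 measure0. Qed.

Let lebesgue_cons_ge0 A : (0 <= lebesgue_cons A)%E.
Proof. exact: measure_ge0. Qed.

Let lebesgue_cons_sigma_additive : semi_sigma_additive lebesgue_cons.
Proof.
exact: (@measure_semi_sigma_additive _ _ _
  (measure_function_pushforward__canonical__measure_function_Measure
     (lebesgue_measure \x mu)%E mtcons)).
Qed.

HB.instance Definition _ := isMeasure.Build _ _ _ lebesgue_cons
  lebesgue_cons0 lebesgue_cons_ge0 lebesgue_cons_sigma_additive.

Let lebesgue_cons_sigma_finite : sigma_finite setT lebesgue_cons.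
Proof.
have /sigma_finiteP[F [TF ndF Foo]] := sigma_finiteT (@lebesgue_measure R).
have /sigma_finiteP[G [TG ndG Goo]] := sigma_finiteT mu.
exists (fun i => [set t | F i (thead t) /\ G i [tuple of behead t]]).
  apply/seteqP; split => // t _.
  have [i _ Fi] : (\bigcup_i F i) (thead t) by rewrite -TF.
  have [j _ Gj] : (\bigcup_i G i) [tuple of behead t] by rewrite -TG.
  exists (maxn i j) => //; split.
  - by move: (thead t) Fi; exact/subsetPset/ndF/leq_maxl.
  - by move: [tuple of behead t] Gj; exact/subsetPset/ndG/leq_maxr.
move=> i; have [mF Fi] := Foo i; have [mG Gi] := Goo i; split.
  apply: measurableI.
    rewrite -[X in measurable X]setTI.
    exact: (@measurable_tnth _ _ n.+1 ord0).
  rewrite -[X in measurable X]setTI.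
  exact: (@measurable_behead _ (measurableTypeR R) n).
rewrite /lebesgue_cons /pushforward.
have -> : tcons @^-1` [set t | F i (thead t) /\ G i [tuple of behead t]] =
    F i `*` G i.
  have tconsK (p : T1 * Tn) : [tuple of behead (tcons p)] = p.2 by exact: val_inj.
  by apply/seteqP; split => p /=; rewrite tconsK theadE.
by rewrite product_measure1E// lte_mul_pinfty// ge0_fin_numE.
Qed.

HB.instance Definition _ := Measure_isSigmaFinite.Build _ _ _ lebesgue_cons
  lebesgue_cons_sigma_finite.

End lebesgue_cons.

Fixpoint lebesgue_tuple (R : realType) (n : nat) :
    {sigma_finite_measure set (n.-tuple (measurableTypeR R)) -> \bar R} :=
  match n with
  | 0 => \d_([tuple] : 0.-tuple (measurableTypeR R))
  | n'.+1 => lebesgue_cons (lebesgue_tuple R n')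
  end.

(* [lebesgue_tuple R n] lives on [n.-tuple R], where the library provides the
   product sigma-algebra; it is transported to row vectors here. *)
Definition integral_Rn (R : realType) (n : nat) (D : set 'rV[R]_n)
    (f : 'rV[R]_n -> R) : R :=
  \int[lebesgue_tuple R n]_(t in [set t | D (\row_j tnth t j)])
    f (\row_j tnth t j).

Section euclidean.
Variable R : realType.

Definition dot n (u v : 'rV[R]_n) : R := \sum_(j < n) u 0 j * v 0 j.

(* The norm of the library on ['rV[R]_n] is the maximum norm. *)
Definition enorm n (u : 'rV[R]_n) : R := Num.sqrt (dot u u).

Definition cross (u v : 'rV[R]_3) : 'rV[R]_3 :=
  \row_(j < 3) [:: u 0 1 * v 0 2 - u 0 2 * v 0 1;
                   u 0 2 * v 0 0 - u 0 0 * v 0 2;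
                   u 0 0 * v 0 1 - u 0 1 * v 0 0]`_j.

Definition crossf T (u v : T -> 'rV[R]_3) : T -> 'rV[R]_3 :=
  fun x => cross (u x) (v x).

Definition convex_hull n (I : finType) (p : I -> 'rV[R]_n) (A : {set I}) :
    set 'rV[R]_n :=
  [set \sum_(i in A) w i *: p i | w in
    [set w : I -> R | (forall i, i \in A -> 0 <= w i) /\ \sum_(i in A) w i = 1]].

Definition affinely_independent n (I : finType) (p : I -> 'rV[R]_n)
    (A : {set I}) : Prop :=
  forall w : I -> R, \sum_(i in A) w i = 0 -> \sum_(i in A) w i *: p i = 0 ->
    forall i, i \in A -> w i = 0.

Definition diameter n (A : set 'rV[R]_n) : R :=
  sup [set enorm (x - y) | x in A & y in A].

Definition inscribed_diameter n (A : set 'rV[R]_n) : R :=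
  sup [set 2 * r | r in
    [set r : R | 0 <= r /\
      exists c, [set x | enorm (x - c) <= r] `<=` A]].

Definition convex_polytopal_domain n (Omega : set 'rV[R]_n) : Prop :=
  [/\ Omega !=set0, open Omega, bounded_set Omega, convex_set Omega &
    exists (m : nat) (p : 'I_m -> 'rV[R]_n),
      closure Omega = convex_hull p [set: 'I_m]].

End euclidean.

(* A mesh is given by its vertices and, for each cell, the set of the indices of
   the vertices of this cell. *)
Record mesh (R : realType) (d : nat) := Mesh {
  nvertices : nat;
  vertex : 'I_nvertices -> 'rV[R]_d;
  cells : {set {set 'I_nvertices}} }.

Section finite_elements.
Variables (R : realType) (d : nat) (Omega : set 'rV[R]_d).

Definition simplex (T : mesh R d) (K : {set 'I_(nvertices T)}) : set 'rV[R]_d :=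
  convex_hull (@vertex R d T) K.

Definition triangulation (T : mesh R d) : Prop :=
  [/\ injective (@vertex R d T),
      forall z, exists2 K, K \in cells T & z \in K,
      forall K, K \in cells T ->
        #|K| = d.+1 /\ affinely_independent (@vertex R d T) K,
      closure Omega = \bigcup_(K in [set` cells T]) simplex K &
      forall K L, K \in cells T -> L \in cells T ->
        simplex K `&` simplex L = simplex (K :&: L)].

Definition mesh_size (T : mesh R d) (h : R) : Prop :=
  (forall K, K \in cells T -> diameter (simplex K) <= h) /\
  exists2 K, K \in cells T & diameter (simplex K) = h.

Definition shape_regular (H : set R) (T : R -> mesh R d) : Prop :=
  exists2 sigma : R, 0 < sigma & forall h, H h -> forall K, K \in cells (T h) ->
    diameter (simplex K) <= sigma * inscribed_diameter (simplex K).

Definition quasi_uniform (H : set R) (T : R -> mesh R d) : Prop :=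
  exists2 c : R, 0 < c & forall h, H h -> forall K, K \in cells (T h) ->
    c * h <= diameter (simplex K).

Definition triangulation_family (H : set R) (T : R -> mesh R d) : Prop :=
  [/\ forall h, H h -> [/\ 0 < h, triangulation (T h) & mesh_size (T h) h],
      shape_regular H T & quasi_uniform H T].

(* Functions on the closure of Omega are represented by total functions; their
   values outside of the closure are irrelevant. *)

Definition affine_on (V : normedModType R) (A : set 'rV[R]_d)
    (v : 'rV[R]_d -> V) : Prop :=
  exists (l : {linear 'rV[R]_d -> V}) (c : V), forall x, A x -> v x = l x + c.

Definition P1 (V : normedModType R) (T : mesh R d) (v : 'rV[R]_d -> V) : Prop :=
  {within closure Omega, continuous v} /\
  forall K, K \in cells T -> affine_on (simplex K) v.

Definition hat (T : mesh R d) (z : 'I_(nvertices T)) : 'rV[R]_d -> R^o :=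
  xget (fun=> 0) [set phi : 'rV[R]_d -> R^o |
    P1 T phi /\ forall y, phi (vertex y) = (y == z)%:R].

Definition beta (T : mesh R d) (z : 'I_(nvertices T)) : R :=
  integral_Rn Omega (hat z).

Definition Vh (T : mesh R d) : set ('rV[R]_d -> 'rV[R]_3) := P1 T.

Definition Mh (T : mesh R d) : set ('rV[R]_d -> 'rV[R]_3) :=
  [set v | Vh T v /\ forall z : 'I_(nvertices T), enorm (v (vertex z)) = 1].

Definition interp (T : mesh R d) (v : 'rV[R]_d -> 'rV[R]_3) :
    'rV[R]_d -> 'rV[R]_3 :=
  fun x => \sum_(z < nvertices T) hat z x *: v (vertex z).

Definition lumped (T : mesh R d) (u v : 'rV[R]_d -> 'rV[R]_3) : R :=
  \sum_(z < nvertices T) beta z * dot (u (vertex z)) (v (vertex z)).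

Definition lumped_norm (T : mesh R d) (v : 'rV[R]_d -> 'rV[R]_3) : R :=
  Num.sqrt (lumped T v v).

(* Pointwise partial derivative in the direction of the j-th unit vector, and 0
   for j >= d, so that [curl] below is the curl of the trivial extension to R^3
   of a function of d variables. P1 functions are differentiable in the interior
   of each cell, and the union of the boundaries of the cells is negligible. *)
Definition partial (j : nat) (v : 'rV[R]_d -> 'rV[R]_3) (x : 'rV[R]_d) :
    'rV[R]_3 :=
  if insub j is Some i then 'D_(delta_mx 0 (i : 'I_d) : 'rV[R]_d) v x else 0.

Definition curl (v : 'rV[R]_d -> 'rV[R]_3) (x : 'rV[R]_d) : 'rV[R]_3 :=
  \row_(j < 3) [:: partial 1%N v x 0 2 - partial 2%N v x 0 1;
                   partial 2%N v x 0 0 - partial 0%N v x 0 2;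
                   partial 0%N v x 0 1 - partial 1%N v x 0 0]`_j.

Definition l2 (u v : 'rV[R]_d -> 'rV[R]_3) : R :=
  integral_Rn Omega (fun x => dot (u x) (v x)).

Definition l2_grad (u v : 'rV[R]_d -> 'rV[R]_3) : R :=
  integral_Rn Omega (fun x => \sum_(i < d) dot (partial i u x) (partial i v x)).

Definition h1_norm (v : 'rV[R]_d -> 'rV[R]_3) : R :=
  Num.sqrt (l2 v v + l2_grad v v).

Definition form_a (ke kd : R) (v chi : 'rV[R]_d -> 'rV[R]_3) : R :=
  ke * l2_grad v chi + kd * l2 v (curl chi) + kd * l2 (curl v) chi.

Definition form_ah (ke kd lambda : R) (T : mesh R d)
    (v chi : 'rV[R]_d -> 'rV[R]_3) : R :=
  form_a ke kd v chi + lambda * lumped T v chi.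

Definition uniformly_coercive (H : set R) (T : R -> mesh R d)
    (ke kd lambda : R) : Prop :=
  exists2 c : R, 0 < c & forall h, H h -> forall v, Vh (T h) v ->
    c * h1_norm v ^+ 2 <= form_ah ke kd lambda (T h) v v.

Definition effective_field (ke kd lambda : R) (T : mesh R d)
    (Hh : ('rV[R]_d -> 'rV[R]_3) -> 'rV[R]_d -> 'rV[R]_3) : Prop :=
  forall v, Vh T v -> Vh T (Hh v) /\
    forall chi, Vh T chi -> lumped T (Hh v) chi = - form_ah ke kd lambda T v chi.

Section solver.
Variables (alpha gamma k : R) (T : mesh R d).
Variable Hh : ('rV[R]_d -> 'rV[R]_3) -> 'rV[R]_d -> 'rV[R]_3.

Definition fixed_point_step (m eta eta' : 'rV[R]_d -> 'rV[R]_3) : Prop :=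
  Vh T eta' /\ forall phi, Vh T phi ->
    lumped T eta' phi + alpha * lumped T (crossf eta' m) phi
      + gamma * k / 2 * lumped T (crossf eta' (Hh eta)) phi
    = lumped T m phi.

Definition residual (eta eta' : 'rV[R]_d -> 'rV[R]_3) : 'rV[R]_d -> 'rV[R]_3 :=
  interp T (crossf eta' (Hh (eta' - eta))).

(* [eps i] is the tolerance for the computation of [m i], [eta i l] the l-th
   iterate of the i-th time step (used for l <= lstar i + 1 only), and [lstar i]
   the stopping index of that step. *)
Definition midpoint_solver (N : nat) (m0 : 'rV[R]_d -> 'rV[R]_3)
    (eps : nat -> R) (lstar : nat -> nat)
    (eta : nat -> nat -> 'rV[R]_d -> 'rV[R]_3)
    (m : nat -> 'rV[R]_d -> 'rV[R]_3) : Prop :=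
  m 0%N = interp T m0 /\
  forall i, (i < N)%N ->
    [/\ Mh T (m i) /\ 0 < eps i.+1,
        eta i 0%N = m i,
        forall l, (l <= lstar i)%N ->
          fixed_point_step (m i) (eta i l) (eta i l.+1),
        lumped_norm T (residual (eta i (lstar i)) (eta i (lstar i).+1))
            <= eps i.+1 /\
          forall l, (l < lstar i)%N ->
            eps i.+1 < lumped_norm T (residual (eta i l) (eta i l.+1)) &
        m i.+1 = 2 *: eta i (lstar i).+1 - m i].

End solver.

End finite_elements.

(* Main.v *)
Require Import Defs.
From HB Require Import structures.
From mathcomp Require Import all_boot all_order all_algebra.
From mathcomp Require Import all_classical all_reals all_analysis.
From mathcomp Require Import ring lra.

Set Implicit Arguments.
Unset Strict Implicit.
Unset Printing Implicit Defensive.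

Import Order.TTheory GRing.Theory Num.Theory.
Import numFieldNormedType.Exports.

Local Open Scope classical_set_scope.
Local Open Scope ring_scope.

(** Write [mb] for the midpoint, [dt] for the difference quotient of the time
    step and [s] for the residual field. Since [m = mb - (k / 2) dt] and
    [mb x mb = 0], the equation of the last fixed-point iteration is
    [<dt, phi> = alpha <mb x dt, phi> - gamma <mb x H mb, phi>
                 + gamma <s, phi>],
    because [H] is linear at the vertices and [s] is exactly the error made by
    freezing the effective field at the previous iterate ([step_weak_form]).
    Testing with [dt] removes the [alpha] term, and testing with [H mb] removes
    the first [gamma] term, both because [(u x v) . v = 0]; the two remaining
    triple products are opposite, so eliminating them gives
    [|dt|^2 = (gamma / alpha) <dt, H mb> + gamma <s, dt>
              - (gamma^2 / alpha) <s, H mb>] ([step_identity]).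
    Finally, [<H mb, dt>] is a difference of energies by the polarization
    identity for the symmetric form [a_h] ([form_ah_midpoint]).

    The form [a_h] is symmetric because exchanging its arguments permutes its
    terms, and the representation [a_h(v, chi) = - <H v, chi>] makes it linear
    in [chi] on the finite element space; hence it is bilinear there. Where
    there is no nodal basis function, [hat] is the zero function, so that the
    vertex has weight 0 in the lumped product and may be ignored
    ([hat_or_beta0]). The geometry of the mesh makes the weights nonnegative, so
    that the lumped norm squared is the lumped product ([lumped_norm_sq]), and
    puts the vertices in the closure of the domain, so that a residual vanishing
    there drops out of the identity. *)

(** * Vector algebra *)

Section vector_algebra.
Variable R : realType.
Implicit Types (n : nat) (a : R).

Lemma dotC n (u v : 'rV[R]_n) : dot u v = dot v u.
Proof. by apply: eq_bigr => j _; rewrite mulrC. Qed.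

Lemma dotDl n (u v w : 'rV[R]_n) : dot (u + v) w = dot u w + dot v w.
Proof.
by rewrite /dot -big_split /=; apply: eq_bigr => j _; rewrite mxE mulrDl.
Qed.

Lemma dotZl n a (u v : 'rV[R]_n) : dot (a *: u) v = a * dot u v.
Proof.
by rewrite /dot big_distrr /=; apply: eq_bigr => j _; rewrite mxE mulrA.
Qed.

Lemma dot_ge0 n (u : 'rV[R]_n) : 0 <= dot u u.
Proof. by apply: sumr_ge0 => j _; rewrite -expr2 sqr_ge0. Qed.

Lemma dot_delta n (u : 'rV[R]_n) j : dot u (delta_mx 0 j) = u 0 j.
Proof.
rewrite /dot (bigD1 j)//= big1 ?addr0 => [|l lj]; rewrite mxE eqxx/=.
  by rewrite eqxx mulr1.
by rewrite (negbTE lj) mulr0.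
Qed.

Lemma row3P (u v : 'rV[R]_3) :
  u 0 0 = v 0 0 -> u 0 1 = v 0 1 -> u 0 2 = v 0 2 -> u = v.
Proof.
move=> u0 u1 u2; apply/rowP => j.
have /or3P[] : [|| j == 0, j == 1 | j == 2] by case: j => -[|[|[|]]].
all: by move/eqP->.
Qed.

Lemma dot3E (u v : 'rV[R]_3) :
  dot u v = u 0 0 * v 0 0 + u 0 1 * v 0 1 + u 0 2 * v 0 2.
Proof.
rewrite /dot !big_ord_recr big_ord0 /= add0r.
by congr (u _ _ * v _ _ + u _ _ * v _ _ + u _ _ * v _ _); apply: val_inj.
Qed.

Lemma crossBr (u v w : 'rV[R]_3) : cross u (v - w) = cross u v - cross u w.
Proof. by apply: row3P; rewrite !mxE /=; ring. Qed.

Lemma dot_cross_swap (u v w : 'rV[R]_3) :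
  dot (cross u v) w = - dot (cross u w) v.
Proof. by rewrite !dot3E !mxE /=; ring. Qed.

End vector_algebra.

(** * The finite element space *)

Section P1_space.
Variables (R : realType) (d : nat) (Omega : set 'rV[R]_d) (T : mesh R d).

Lemma P1_comb (V : normedModType R) a (u v : 'rV[R]_d -> V) :
  P1 Omega T u -> P1 Omega T v -> P1 Omega T (a *: u + v).
Proof.
move=> [cu lu] [cv lv]; split.
  apply: within_continuousD => // x.
  exact: continuous_comp (cu x) (@scaler_continuous _ _ a (u x)).
move=> K TK; have [l [c uE]] := lu K TK; have [l' [c' vE]] := lv K TK.
exists (a \*: l \+ l'), (a *: c + c') => x Kx.
by rewrite [LHS]/(a *: u x + v x) uE// vE// scalerDr addrACA.
Qed.

Lemma P1Z (V : normedModType R) a (u : 'rV[R]_d -> V) :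
  P1 Omega T u -> P1 Omega T (a *: u).
Proof.
move=> Pu.
have -> : a *: u = (a - 1) *: u + u.
  by rewrite scalerBl scale1r subrK.
exact: P1_comb.
Qed.

Lemma P1B (V : normedModType R) (u v : 'rV[R]_d -> V) :
  P1 Omega T u -> P1 Omega T v -> P1 Omega T (u - v).
Proof. by move=> Pu Pv; rewrite addrC -scaleN1r; exact: P1_comb. Qed.

Lemma P1_scalel (V : normedModType R) (phi : 'rV[R]_d -> R^o) (e : V) :
  P1 Omega T phi -> P1 Omega T (fun x => phi x *: e).
Proof.
move=> [cphi lphi]; split.
  move=> x; exact: continuous_comp (cphi x) (@scalel_continuous _ _ e (phi x)).
move=> K TK; have [l [c phiE]] := lphi K TK.
pose f x := (l x : R) *: e.
have lin_f : linear f.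
  by move=> a x y; rewrite /f linearP /= scalerDl -scalerA.
pose L := HB.pack_for {linear 'rV[R]_d -> V} f
  (GRing.isLinear.Build R 'rV[R]_d V *:%R f lin_f).
by exists L, ((c : R) *: e) => x Kx; rewrite phiE// scalerDl.
Qed.

(** [hat] defaults to the zero function, whose integral is 0; so a nonzero
    weight certifies a genuine nodal basis function. *)
Lemma hat_or_beta0 z : beta Omega z != 0 ->
  P1 Omega T (hat Omega z) /\
  forall y, hat Omega z (@vertex _ _ T y) = (y == z)%:R.
Proof.
rewrite /beta /hat; case: xgetP => [phi _ //|_].
by rewrite /integral_Rn /Rintegral integral0 fine0 eqxx.
Qed.

Lemma hat_neq z y : y != z -> hat Omega z (@vertex _ _ T y) = 0.
Proof.
rewrite /hat; case: xgetP => [phi _ [_ ->] /negbTE->|] //.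
Qed.

(** A vertex without nodal basis function is not interpolated, but it has
    weight 0. *)
Lemma interp_vertex v z : beta Omega z != 0 ->
  interp Omega T v (@vertex _ _ T z) = v (vertex z).
Proof.
move=> /hat_or_beta0[_ hatE]; rewrite /interp (bigD1 z)//= hatE eqxx scale1r.
by rewrite big1 ?addr0 // => y yz; rewrite hat_neq ?scale0r // eq_sym.
Qed.

Lemma lumpedC u v : lumped Omega T u v = lumped Omega T v u.
Proof. by apply: eq_bigr => z _; rewrite dotC. Qed.

Lemma lumpedDl u v w :
  lumped Omega T (u + v) w = lumped Omega T u w + lumped Omega T v w.
Proof.
by rewrite /lumped -big_split; apply: eq_bigr => z _; rewrite dotDl mulrDr.
Qed.

Lemma lumpedZl a u w : lumped Omega T (a *: u) w = a * lumped Omega T u w.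
Proof.
by rewrite /lumped big_distrr; apply: eq_bigr => z _; rewrite dotZl /= mulrCA.
Qed.

Lemma lumpedBl u v w :
  lumped Omega T (u - v) w = lumped Omega T u w - lumped Omega T v w.
Proof. by rewrite -scaleN1r lumpedDl lumpedZl mulN1r. Qed.

Lemma lumpedZr a u w : lumped Omega T w (a *: u) = a * lumped Omega T w u.
Proof. by rewrite lumpedC lumpedZl lumpedC. Qed.

Lemma lumpedBr u v w :
  lumped Omega T w (u - v) = lumped Omega T w u - lumped Omega T w v.
Proof. by rewrite ![lumped _ _ w _]lumpedC lumpedBl. Qed.

Lemma eq_lumpedl u v w :
  (forall z, beta Omega z != 0 -> u (@vertex _ _ T z) = v (vertex z)) ->
  lumped Omega T u w = lumped Omega T v w.
Proof.
move=> uv; apply: eq_bigr => z _.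
by have [->|/uv->//] := eqVneq (beta Omega z) 0; rewrite !mul0r.
Qed.

Lemma lumped_cross_swap u v w :
  lumped Omega T (crossf u v) w = - lumped Omega T (crossf u w) v.
Proof.
rewrite /lumped -sumrN; apply: eq_bigr => z _.
by rewrite dot_cross_swap mulrN.
Qed.

Lemma lumped_cross_self u v : lumped Omega T (crossf u v) v = 0.
Proof. by have := lumped_cross_swap u v v; lra. Qed.

(** The test functions [hat z *: e_j] read off the components at the vertex
    [z]. *)
Lemma lumped_inj u v :
  (forall phi, Vh Omega T phi -> lumped Omega T u phi = lumped Omega T v phi) ->
  forall z, beta Omega z != 0 -> u (@vertex _ _ T z) = v (vertex z).
Proof.
move=> uv z bz; have [P1z hatE] := hat_or_beta0 bz; apply/rowP => j.
have := uv _ (P1_scalel (delta_mx 0 j : 'rV[R]_3) P1z).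
have lumped_hat w :
    lumped Omega T w (fun x => hat Omega z x *: (delta_mx 0 j : 'rV[R]_3)) =
    beta Omega z * w (vertex z) 0 j.
  rewrite /lumped (bigD1 z)//= big1 ?addr0 => [|y yz].
    by rewrite hatE eqxx scale1r dot_delta.
  by rewrite hatE (negbTE yz) scale0r dotC -(scale0r 0) dotZl mul0r mulr0.
by rewrite !lumped_hat => /(mulfI bz).
Qed.

Lemma vertex_simplex (K : {set 'I_(nvertices T)}) z :
  z \in K -> simplex K (@vertex _ _ T z).
Proof.
move=> Kz; exists (fun y => (y == z)%:R); first split=> [y _|].
- exact: ler0n.
- by rewrite (bigD1 z)//= eqxx big1 ?addr0// => y /andP[_ /negbTE->].
rewrite (bigD1 z)//= eqxx scale1r big1 ?addr0// => y /andP[_ /negbTE->].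
by rewrite scale0r.
Qed.

Hypothesis hT : triangulation Omega T.

Lemma vertex_closure z : closure Omega (@vertex _ _ T z).
Proof.
have [_ zT _ -> _] := hT; have [K TK Kz] := zT z; exists K => //.
exact: vertex_simplex.
Qed.

(** On a cell, a nodal basis function is an affine function of a convex
    combination of the vertices, hence the same convex combination of its values
    0 and 1 there. *)
Lemma hat_ge0 (z : 'I_(nvertices T)) x :
  closure Omega x -> 0 <= (hat Omega z x : R) :> R.
Proof.
have [_ _ _ -> _] := hT => -[K TK [w [w0 w1] <-]].
rewrite /hat; case: xgetP => [phi _ [[_ /(_ K TK)[l [c phiE]]] phiv]|//].
have -> : phi (\sum_(i in K) w i *: vertex i) =
    \sum_(i in K) w i * phi (vertex i).
  rewrite phiE; last by exists w.
  rewrite linear_sum /= -[c]mul1r -w1 big_distrl -big_split /=.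
  apply: eq_bigr => i Ki.
  by rewrite (phiE (vertex i)) ?linearZ ?mulrDr//; exact: vertex_simplex.
by apply: sumr_ge0 => i Ki; rewrite phiv mulr_ge0 ?w0 ?ler0n.
Qed.

Lemma beta_ge0 (z : 'I_(nvertices T)) : 0 <= beta Omega z.
Proof. by apply: Rintegral_ge0 => t Ot; apply/hat_ge0/subset_closure. Qed.

Lemma lumped_norm_sq u : lumped_norm Omega T u ^+ 2 = lumped Omega T u u.
Proof.
rewrite sqr_sqrtr //; apply: sumr_ge0 => z _.
by rewrite mulr_ge0 ?beta_ge0 ?dot_ge0.
Qed.

End P1_space.

(** * The discrete effective field *)

Section effective_field_theory.
Variables (R : realType) (d : nat) (Omega : set 'rV[R]_d) (T : mesh R d).
Variables (ke kd lambda : R).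
Variable Hh : ('rV[R]_d -> 'rV[R]_3) -> 'rV[R]_d -> 'rV[R]_3.
Hypothesis hHh : effective_field Omega ke kd lambda T Hh.

Let ah := form_ah Omega ke kd lambda T.

Lemma l2C (u v : 'rV[R]_d -> 'rV[R]_3) : l2 Omega u v = l2 Omega v u.
Proof. by congr integral_Rn; apply/funext => x; rewrite dotC. Qed.

Lemma l2_gradC (u v : 'rV[R]_d -> 'rV[R]_3) :
  l2_grad Omega u v = l2_grad Omega v u.
Proof.
by congr integral_Rn; apply/funext => x; apply: eq_bigr => i _; rewrite dotC.
Qed.

Lemma form_ahC u v : ah u v = ah v u.
Proof.
rewrite /ah /form_ah /form_a l2_gradC lumpedC [l2 _ u _]l2C [l2 _ _ v]l2C.
by congr (_ + _); rewrite addrAC.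
Qed.

Lemma form_ahE u v : Vh Omega T u -> Vh Omega T v ->
  ah u v = - lumped Omega T (Hh u) v.
Proof. by move=> /hHh[_ HuE] /HuE->; rewrite opprK. Qed.

Lemma effective_field_selfadjoint u v : Vh Omega T u -> Vh Omega T v ->
  lumped Omega T (Hh u) v = lumped Omega T (Hh v) u.
Proof.
by move=> Vu Vv; apply: oppr_inj; rewrite -!form_ahE// form_ahC.
Qed.

(** Self-adjointness moves the difference to the second argument of the lumped
    product, where linearity is clear. *)
Lemma effective_fieldB u v z : Vh Omega T u -> Vh Omega T v ->
  beta Omega z != 0 ->
  Hh (u - v) (@vertex _ _ T z) = Hh u (vertex z) - Hh v (vertex z).
Proof.
move=> Vu Vv; apply: (@lumped_inj _ _ Omega T _ (Hh u - Hh v)) => phi Vphi.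
have Vuv : Vh Omega T (u - v) by exact: P1B.
rewrite effective_field_selfadjoint// lumpedBr lumpedBl.
by rewrite !(@effective_field_selfadjoint phi).
Qed.

(** Polarization for the bilinear form [ah]: the points [2 w - v] and [v] have
    the midpoint [w]. *)
Lemma form_ah_midpoint w v : Vh Omega T w -> Vh Omega T v ->
  ah (2 *: w - v) (2 *: w - v) - ah v v = - 4 * lumped Omega T (Hh w) (w - v).
Proof.
move=> Vw Vv; have Vu : Vh Omega T (2 *: w - v) by apply: P1B => //; exact: P1Z.
rewrite !form_ahE// !lumpedBr lumpedZr.
rewrite !(@effective_field_selfadjoint (2 *: w - v))// !lumpedBr !lumpedZr.
by rewrite (@effective_field_selfadjoint v w)//; ring.
Qed.

(** * One step of the inexact midpoint scheme *)

Variables (alpha gamma k : R).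
Hypotheses (alpha_gt0 : 0 < alpha) (k_gt0 : 0 < k).
Variables (m eta mb : 'rV[R]_d -> 'rV[R]_3).
Hypotheses (Vm : Vh Omega T m) (Veta : Vh Omega T eta).
Hypothesis step : fixed_point_step Omega alpha gamma k T Hh m eta mb.

Let dt := k^-1 *: (2 *: mb - m - m).
Let s := interp Omega T (crossf mb (Hh (mb - eta))).

Let Vmb : Vh Omega T mb. Proof. by case: step. Qed.

Let Vdt : Vh Omega T dt.
Proof. by apply/P1Z/P1B => //; apply: P1B => //; exact: P1Z. Qed.

(** The cross product with [mb] turns [m] into a multiple of [dt], and the frozen
    field [Hh eta] differs from [Hh mb] by the field in the residual. *)
Lemma step_weak_form phi : Vh Omega T phi ->
  lumped Omega T dt phi = alpha * lumped Omega T (crossf mb dt) phi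
    - gamma * lumped Omega T (crossf mb (Hh mb)) phi
    + gamma * lumped Omega T s phi.
Proof.
have [_ /[apply]] := step.
(* This holds only at the vertices of nonzero weight, where [Hh] is additive. *)
have -> : lumped Omega T (crossf mb (Hh eta)) phi =
    lumped Omega T (crossf mb (Hh mb)) phi - lumped Omega T s phi.
  rewrite -lumpedBl; apply: eq_lumpedl => z bz.
  have sE : s (vertex z) = cross (mb (vertex z)) (Hh mb (vertex z))
      - cross (mb (vertex z)) (Hh eta (vertex z)).
    by rewrite /s interp_vertex// /crossf effective_fieldB// crossBr.
  suff : cross (mb (vertex z)) (Hh eta (vertex z)) =
      cross (mb (vertex z)) (Hh mb (vertex z)) - s (vertex z) by [].
  by rewrite sE subKr.
have -> : crossf mb m = - (k / 2) *: crossf mb dt.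
  apply/funext => x.
  suff : cross (mb x) (m x) =
      - (k / 2) *: cross (mb x) (k^-1 *: (2 *: mb x - m x - m x)) by [].
  by apply: row3P; rewrite !mxE /=; field; rewrite gt_eqF.
rewrite lumpedZl => stepE.
rewrite /dt lumpedZl !lumpedBl lumpedZl -/dt -stepE.
set x := lumped _ _ mb _; set y := lumped _ _ _ _; set z := lumped _ _ _ _.
by set w := lumped _ _ _ _; field; rewrite gt_eqF.
Qed.

(** The test functions [dt] and [Hh mb] each cancel one of the two triple
    products; the surviving ones are opposite to each other. *)
Lemma step_identity :
  lumped Omega T dt dt = gamma / alpha * lumped Omega T (Hh mb) dt
    + gamma * lumped Omega T s dt
    - gamma ^+ 2 / alpha * lumped Omega T s (Hh mb).
Proof.
have [VHmb _] := hHh Vmb.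
have := step_weak_form Vdt; rewrite lumped_cross_self => ->.
have := step_weak_form VHmb; rewrite lumped_cross_self lumped_cross_swap.
rewrite [lumped _ _ dt _]lumpedC => ->; field; rewrite gt_eqF//.
Qed.

Lemma step_energy_law : triangulation Omega T ->
  lumped_norm Omega T dt ^+ 2
    + gamma / (2 * alpha * k) * (ah (2 *: mb - m) (2 *: mb - m) - ah m m)
  = gamma * lumped Omega T s dt
    - gamma ^+ 2 / alpha * lumped Omega T s (Hh mb).
Proof.
move=> hT; rewrite lumped_norm_sq// step_identity form_ah_midpoint//.
have -> : lumped Omega T (Hh mb) dt =
    2 / k * lumped Omega T (Hh mb) (mb - m).
  by rewrite lumpedZr !lumpedBr lumpedZr; ring.
by field; rewrite !gt_eqF.
Qed.

End effective_field_theory.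

Theorem lemma4p6 (R : realType) (d : nat) (hd : (1 <= d <= 3)%N)
    (Omega : set 'rV[R]_d) (hOmega : convex_polytopal_domain Omega)
    (Tf alpha gamma ke kd : R)
    (hTf : 0 < Tf) (halpha : 0 < alpha) (hgamma : 0 < gamma) (hke : 0 < ke)
    (m0 : 'rV[R]_d -> 'rV[R]_3)
    (hm0 : {within closure Omega, continuous m0})
    (hm0_unit : forall x, closure Omega x -> enorm (m0 x) = 1)
    (N : nat)
    (H : set R) (T : R -> mesh R d) (hT : triangulation_family Omega H T)
    (lambda : R) (hlambda : 0 < lambda)
    (hcoercive : uniformly_coercive Omega H T ke kd lambda)
    (h : R) (hh : H h)
    (Hh : ('rV[R]_d -> 'rV[R]_3) -> 'rV[R]_d -> 'rV[R]_3)
    (hHh : effective_field Omega ke kd lambda (T h) Hh)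
    (eps : nat -> R) (lstar : nat -> nat)
    (eta : nat -> nat -> 'rV[R]_d -> 'rV[R]_3)
    (m : nat -> 'rV[R]_d -> 'rV[R]_3)
    (hm : midpoint_solver Omega alpha gamma (Tf / N%:R) (T h) Hh N m0
            eps lstar eta m)
    (i : nat) (hi : (i < N)%N) :
  let k := Tf / N%:R in
  let ah := form_ah Omega ke kd lambda (T h) in
  let mbar := eta i (lstar i).+1 in
  let dtm := k^-1 *: (m i.+1 - m i) in
  let s := interp Omega (T h)
             (crossf mbar (Hh (eta i (lstar i).+1 - eta i (lstar i)))) in
  lumped_norm Omega (T h) dtm ^+ 2
    + gamma / (2 * alpha * k) * (ah (m i.+1) (m i.+1) - ah (m i) (m i))
  = gamma * lumped Omega (T h) s dtm
    - gamma ^+ 2 / alpha * lumped Omega (T h) s (Hh mbar)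
  /\ ((forall x, closure Omega x -> s x = 0) ->
      gamma / (2 * alpha) * (ah (m i.+1) (m i.+1) - ah (m i) (m i))
        + k * lumped_norm Omega (T h) dtm ^+ 2 = 0).
Proof.
move=> k ah mbar dtm s; have [_ /(_ _ hi)[[[Vmi _] _] eta0 steps _ mS]] := hm.
have [/(_ _ hh)[_ triT _] _ _] := hT.
have k_gt0 : 0 < k by rewrite divr_gt0// ltr0n (leq_trans _ hi).
have Veta : Vh Omega (T h) (eta i (lstar i)).
  case El : (lstar i) => [|l]; first by rewrite eta0.
  by have [] := steps l; rewrite ?El.
have /= law :=
  step_energy_law hHh halpha k_gt0 Vmi Veta (steps _ (leqnn _)) triT.
rewrite /dtm mS; split=> [|s0]; first exact: law.
have lumped_s u : lumped Omega (T h) s u = 0.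
  rewrite /lumped big1// => z _; rewrite s0; last exact: vertex_closure.
  by rewrite /dot big1 ?mulr0// => j _; rewrite mxE mul0r.
move: law; rewrite -/s !lumped_s !mulr0 subr0 -/mbar -/ah -/k.
set E := ah _ _ - _; set n2 := lumped_norm _ _ _ ^+ 2 => law.
suff -> : gamma / (2 * alpha) * E + k * n2
    = k * (n2 + gamma / (2 * alpha * k) * E) by rewrite law mulr0.
by field; rewrite !gt_eqF.
Qed.
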